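(* There exists a complete Boolean algebra $C$ whose Scott space $\Sigma C$ is not co-sober.
   Context: A subset $U$ of a poset $P$ is Scott open if it is an upper set and, whenever a directed (in particular nonempty) set $D\subseteq P$ has a supremum with $\bigvee D\in U$, one has $D\cap U\neq\varnothing$; the Scott space $\Sigma P$ is $P$ with the topology of Scott open sets. Its specialization order is the original order of $P$. Compactness means that every open cover has a finite subcover (no separation axiom is assumed). A subset of a $T_0$-space is saturated if it is an intersection of open sets (equivalently, an upper set in the specialization order, where $x\leq y$ iff $x\in\operatorname{cl}\{y\}$). For a $T_0$-space $X$, let $\mathcal{Q}(X)$ be the family of nonempty compact saturated subsets of $X$. An element $K\in\mathcal{Q}(X)$ is $k$-irreducible if $K=K_1\cup K_2$ with $K_1,K_2\in\mathcal{Q}(X)$ implies $K=K_1$ or $K=K_2$. The space $X$ is co-sober if every $k$-irreducible $K\in\mathcal{Q}(X)$ has the form ${\uparrow}x=\{y\in X:x\leq y\}$ (specialization order) for some point $x\in X$. *)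

(* Defs.v *)
From HB Require Import structures.
From mathcomp Require Import all_boot all_order.
From mathcomp Require Import all_classical topology.

Set Implicit Arguments.
Unset Strict Implicit.
Unset Printing Implicit Defensive.

Import Order.TTheory.

Local Open Scope order_scope.
Local Open Scope classical_set_scope.

Definition complete_lattice d (L : latticeType d) : Prop :=
  forall A : set L, supremums A !=set0 /\ infimums A !=set0.

Section Scott.
Context {d : Order.disp_t} {P : porderType d}.
Implicit Types (D U : set P).

Definition upper_set U : Prop := forall x y : P, x <= y -> U x -> U y.

Definition directed D : Prop :=
  D !=set0 /\
  forall x y, D x -> D y -> exists z, [/\ D z, x <= z & y <= z].

Definition scott_open U : Prop :=
  upper_set U /\
  forall D s, directed D -> supremums D s -> U s -> D `&` U !=set0.

Lemma scott_openT : scott_open setT.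
Proof. by split=> // D s [[x Dx] _] _ _; exists x. Qed.

Lemma scott_openI : setI_closed scott_open.
Proof.
move=> U V [uU sU] [uV sV]; split.
  by move=> x y xy [Ux Vx]; split; [exact: uU Ux | exact: uV Vx].
move=> D s dD sD [Us Vs].
have [x [Dx Ux]] := sU _ _ dD sD Us.
have [y [Dy Vy]] := sV _ _ dD sD Vs.
have [z [Dz xz yz]] := dD.2 _ _ Dx Dy.
by exists z; split=> //; split; [exact: uU Ux | exact: uV Vy].
Qed.

Lemma scott_open_bigcup (I : Type) (f : I -> set P) :
  (forall i, scott_open (f i)) -> scott_open (\bigcup_i f i).
Proof.
move=> fo; split.
  by move=> x y xy [i _ fx]; exists i => //; exact: (fo i).1 fx.
move=> D s dD sD [i _ fs].
by have [x [Dx fx]] := (fo i).2 _ _ dD sD fs; exists x; split=> //; exists i.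
Qed.

End Scott.

(* An alias of P, so that the Scott topology cannot clash with another
   topology on the carrier. *)
Definition scott_space {d} (P : porderType d) : Type := P.

HB.instance Definition _ d (P : porderType d) :=
  Choice.copy (scott_space P) P.
HB.instance Definition _ d (P : porderType d) :=
  isOpenTopological.Build (scott_space P)
    (@scott_openT d P) (@scott_openI d P) (@scott_open_bigcup d P).

Section CoSober.
Context {X : topologicalType}.
Implicit Types (K : set X).

Definition specialization (x y : X) : Prop := closure [set y] x.

Definition principal_filter (x : X) : set X := [set y | specialization x y].

Definition saturated K : Prop :=
  exists2 F : set (set X), F `<=` open & K = \bigcap_(U in F) U.

Definition compact_saturated : set (set X) :=
  [set K | [/\ K !=set0, cover_compact K & saturated K]].

Definition k_irreducible K : Prop :=
  compact_saturated K /\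
  forall K1 K2, compact_saturated K1 -> compact_saturated K2 ->
    K = K1 `|` K2 -> K = K1 \/ K = K2.

End CoSober.

(* Only meaningful for T0 spaces; Scott spaces are T0 by [scott_T0]. *)
Definition co_sober (X : topologicalType) : Prop :=
  forall K : set X, k_irreducible K -> exists x : X, K = principal_filter x.

Lemma scott_openE d (P : porderType d) :
  @open (scott_space P) = @scott_open d P.
Proof. by []. Qed.

Lemma scott_specialization d (P : porderType d) (x y : P) :
  @specialization (scott_space P) x y <-> x <= y.
Proof.
split=> [xy | xy U].
  apply: contrapT => nxy.
  have oV : @open (scott_space P) [set z : P | ~ z <= y].
    rewrite scott_openE; split=> /= [a b ab nay ay | D s dD [_ sD] nsy].
      by apply: nay; exact: le_trans ab ay.
    apply: contrapT => DV; apply: nsy; apply: sD => z Dz.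
    by apply: contrapT => nzy; apply: DV; exists z.
  by have [z [/= -> ]] := xy _ (open_nbhs_nbhs (conj oV nxy)); apply.
rewrite nbhsE => -[V [oV Vx] VU]; exists y; split=> //; apply: VU.
by move: oV; rewrite scott_openE => -[uV _]; exact: uV xy Vx.
Qed.

Lemma scott_T0 d (P : porderType d) : kolmogorov_space (scott_space P).
Proof.
suff sep (x y : P) : ~ x <= y ->
    exists A : set P, @nbhs _ (scott_space P) x A /\ ~ A y.
  move=> x y xNy; have [xy|/negP nxy] := boolP ((x : P) <= y).
    have nyx : ~ (y : P) <= x.
      by move=> yx; move/eqP: xNy; apply; apply/le_anti/andP; split.
    have [A [nA NA]] := sep _ _ nyx.
    by exists A; right; split; apply/mem_set.
  have [A [nA NA]] := sep _ _ nxy.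
  by exists A; left; split; apply/mem_set.
move=> nxy; apply: contrapT => H; apply: nxy.
apply/scott_specialization => U nU; exists y; split=> //.
by apply: contrapT => NU; apply: H; exists U.
Qed.

(* Main.v *)
(* Let [X] be a compact T1 space with at least two points in which any two
   nonempty open sets meet and in which a set [B] is closed as soon as it
   contains [x] whenever it meets all members of a filtered family of closed
   sets with intersection [{x}].

   Topologize the subsets [Z] of [X] by the basic sets
   [{Z | F <= Z, Z disjoint from s}], with [F] closed and [s] finite, and let
   [C] be the complete Boolean algebra of regular open sets of this space. Put
   [c_x = {Z | x in Z}]. If filtered closed [F_i] shrink to [{x}], then [c_x] is
   the directed supremum of the [{Z | F_i <= Z}]; by the assumption on closed
   sets, [x |-> c_x] is therefore continuous, so the upper set [K] generated by
   the [c_x] is compact. For [F] closed, the elements below some [c_y], [y] in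
   [F], form a Scott closed set, because [{y | d <= c_y}] is closed and [X] is
   compact; hence, by the same assumption, every compact saturated subset of [K]
   contains the [c_x] of a closed set of points [x]. As [X] is irreducible, [K]
   is k-irreducible, and it is not principal because the [c_x] form an
   antichain.

   For [X] take the one-point compactification of a countable sequential space
   in which each pair [(p, q)] carries a copy of [nat * nat] whose rows converge
   to [p] and whose graphs of functions converge to [q]: a neighbourhood of [p]
   contains almost all of every row, hence all of some graph of a function, and
   so it meets every neighbourhood of [q]. *)
From HB Require Import structures.
Require Import Defs.
From mathcomp Require Import all_boot all_order finmap.
From mathcomp Require Import all_classical topology.

Set Implicit Arguments.
Unset Strict Implicit.
Unset Printing Implicit Defensive.

Import Order.TTheory.

Local Open Scope order_scope.
Local Open Scope classical_set_scope.

(** * Compactness through directed covers and filtered families of closed sets *)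

Section Directed.
Context {T : topologicalType}.

Definition directed_cover (UU : set (set T)) (K : set T) : Prop :=
  [/\ UU !=set0,
      forall U V, UU U -> UU V -> exists2 W, UU W & U `|` V `<=` W &
      K `<=` \bigcup_(U in UU) U].

(** Finite unions of members of an open cover form a directed cover; conversely, directedness
    swallows a finite subcover into one member. *)
Lemma cover_compactP (K : set T) : cover_compact K <->
  forall UU : set (set T), UU `<=` open -> directed_cover UU K ->
    exists2 U, UU U & K `<=` U.
Proof.
split=> [cK UU oUU [[U0 U0U] dUU KUU] | cK I D f of_ Kf].
  have [D' D'U KD'] := cK _ UU id oUU KUU.
  suff [W UW D'W] : exists2 W, UU W & forall U, U \in enum_fset D' -> U `<=` W.
    by exists W => // x /KD' [U /= UD' Ux]; exact: D'W UD' _ Ux.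
  have {D'U} : {in enum_fset D', forall U, UU U}.
    by move=> U /D'U; rewrite inE.
  elim: (enum_fset D') => [_|U s IHs sU]; first by exists U0.
  have [W UW sW] : exists2 W, UU W & forall U, U \in s -> U `<=` W.
    by apply: IHs => V Vs; apply: sU; rewrite inE Vs orbT.
  have [V UV UWV] := dUU _ _ (sU U (mem_head _ _)) UW.
  exists V => // A; rewrite inE => /predU1P[->|/sW AW] x Ax.
    by apply: UWV; left.
  by apply: UWV; right; exact: AW.
have [||_ [D' D'D ->] KD'] := cK
    [set U | exists2 D' : {fset I}, {subset D' <= D} &
                 U = cover [set` D'] f].
- move=> U [D' D'D ->]; apply: bigcup_open => i /D'D.
  by rewrite inE; exact: of_.
- split.
  + by exists (cover [set` fset0] f), fset0.
  + move=> U V [A AD ->] [B BD ->]; exists (cover [set` (A `|` B)%fset] f).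
      exists (A `|` B)%fset => // i; rewrite inE => /orP[/AD|/BD] //.
    move=> x [] [i /= iA fx]; exists i => //=; rewrite inE iA ?orbT //.
  + move=> x /Kf [i Di fx]; exists (cover [set` [fset i]%fset] f).
      by exists [fset i]%fset => // j; rewrite !inE => /eqP ->.
    by exists i => //=; rewrite inE.
- by exists D'.
Qed.

Definition filtered (FF : set (set T)) : Prop :=
  FF !=set0 /\
  forall F G, FF F -> FF G -> exists2 H, FF H & H `<=` F `&` G.

(** Otherwise the complements form a directed open cover, so one of them is the whole space and its
    [F] is empty. *)
Lemma cover_compact_filtered (FF : set (set T)) :
    cover_compact [set: T] -> FF `<=` closed -> filtered FF ->
    (forall F, FF F -> F !=set0) ->
  \bigcap_(F in FF) F !=set0.
Proof.
move=> /cover_compactP cT cFF [[F0 FF0] dFF] FFn0; apply: contrapT => capF.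
have [||_ [F FFF <-] TF] := cT [set U | exists2 F, FF F & ~` F = U].
- by move=> _ [F /cFF cF <-]; exact: closed_openC.
- split; first by exists (~` F0), F0.
    move=> _ _ [F FFF <-] [G FFG <-]; have [H FFH HFG] := dFF _ _ FFF FFG.
    exists (~` H); first by exists H.
    by move=> x [nx /HFG[]|nx /HFG[]].
  move=> x _; apply: contrapT => nx; apply: capF; exists x => F FFF.
  by apply: contrapT => nFx; apply: nx; exists (~` F) => //; exists F.
by have [x Fx] := FFn0 _ FFF; exact: (TF x).
Qed.

Lemma filtered_avoid (FF : set (set T)) (x : T) (s : seq T) :
    filtered FF -> \bigcap_(F in FF) F `<=` [set x] -> x \notin s ->
  exists2 F, FF F & forall b, b \in s -> ~ F b.
Proof.
move=> [[F0 FF0] dFF] capF; elim: s => [_|b s IHs]; first by exists F0.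
rewrite inE negb_or => /andP[xNb /IHs[F FFF Fs]].
have [G FFG nGb] : exists2 G, FF G & ~ G b.
  apply: contrapT => nG; move/eqP: xNb; apply; apply/esym/capF => G FFG.
  by apply: contrapT => nGb; apply: nG; exists G.
have [H FFH HFG] := dFF _ _ FFF FFG; exists H => // y.
by rewrite inE => /predU1P[->|/Fs nFy] /HFG[].
Qed.

End Directed.

(** * The complete Boolean algebra of regular open sets *)

Section RegularOpen.
Context {T : topologicalType}.

Record regular_open : Type := RegularOpen {
  regular_open_val : set T;
  regular_openP : `[< regopen regular_open_val >] }.

HB.instance Definition _ := [isSub for regular_open_val].
HB.instance Definition _ := [Choice of regular_open by <:].

Implicit Types (A B D : regular_open).

Lemma regular_openE A : (closure (val A))° = val A.
Proof. exact/asboolP/(regular_openP A). Qed.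

Lemma open_regular_open A : open (val A).
Proof. by rewrite -regular_openE; exact: open_interior. Qed.

Lemma clopen_regopen (U : set T) : open U -> closed U -> regopen U.
Proof.
by move=> oU /closure_id cU; rewrite /regopen -cU; exact/interior_id.
Qed.

Lemma sub_regular_open (U : set T) A :
  open U -> U `<=` closure (val A) -> U `<=` val A.
Proof. by move=> oU UA; rewrite -regular_openE -open_subsetE. Qed.

Definition of_clopen (U : set T) (oU : open U) (cU : closed U) : regular_open :=
  RegularOpen (asboolT (clopen_regopen oU cU)).

Definition regularize (U : set T) : regular_open :=
  RegularOpen (asboolT (interior_closure_idem U)).

Lemma sub_regularize (U : set T) : open U -> U `<=` val (regularize U).
Proof. by move=> oU; rewrite -open_subsetE//; exact: subset_closure. Qed.

Lemma regularize_sub (U : set T) A :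
  U `<=` val A -> val (regularize U) `<=` val A.
Proof. by move=> UA; rewrite -(regular_openE A); apply/interiorS/closureS. Qed.

Definition ro_le A B : bool := `[< val A `<=` val B >].
Definition ro_meet A B : regular_open := regularize (val A `&` val B).
Definition ro_join A B : regular_open := regularize (val A `|` val B).
Definition ro_compl A : regular_open := regularize (~` closure (val A)).

Lemma ro_le_refl : reflexive ro_le.
Proof. by move=> A; apply/asboolP. Qed.

Lemma ro_le_anti : antisymmetric ro_le.
Proof.
by move=> A B /andP[/asboolP AB /asboolP BA]; apply/val_inj/seteqP.
Qed.

Lemma ro_le_trans : transitive ro_le.
Proof.
by move=> B A D /asboolP AB /asboolP BD; apply/asboolP/(subset_trans AB).
Qed.

Fact ro_display : Order.disp_t. Proof. exact: Order.Disp tt tt. Qed.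

HB.instance Definition _ := Order.Le_isPOrder.Build ro_display regular_open
  ro_le_refl ro_le_anti ro_le_trans.

Lemma leEro A B : (A <= B) <-> val A `<=` val B.
Proof. by split=> [/asboolP|AB]; last apply/asboolP. Qed.

Lemma val_ro_meet A B : val (ro_meet A B) = val A `&` val B.
Proof.
apply/seteqP; split; last first.
  by apply/sub_regularize/openI; exact: open_regular_open.
by rewrite subsetI; split; apply: regularize_sub => x [].
Qed.

Lemma ro_meetP A B D : (A <= ro_meet B D) = (A <= B) && (A <= D).
Proof.
apply/idP/andP => [/leEro|[/leEro AB /leEro AD]].
  by rewrite val_ro_meet subsetI => -[AB AD]; split; apply/leEro.
by apply/leEro; rewrite val_ro_meet subsetI.
Qed.

Lemma ro_joinP A B D : (ro_join A B <= D) = (A <= D) && (B <= D).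
Proof.
have sAB : val A `|` val B `<=` val (ro_join A B).
  by apply/sub_regularize/openU; exact: open_regular_open.
apply/idP/andP => [/leEro ABD|[/leEro AD /leEro BD]].
  by split; apply/leEro => x xAB; apply/ABD/sAB; [left|right].
by apply/leEro/regularize_sub; rewrite subUset.
Qed.

HB.instance Definition _ := Order.POrder_MeetJoin_isLattice.Build ro_display
  regular_open ro_meetP ro_joinP.

Lemma val_meet A B : val (A `&` B)%O = val A `&` val B.
Proof. exact: val_ro_meet. Qed.

Lemma val_join A B : val (A `|` B)%O = (closure (val A `|` val B))°.
Proof. by []. Qed.

(** The nontrivial inequality holds because a neighbourhood of a point of the open set [D] can be
    cut down to [D] before it is tested against [A] and [B]. *)
Lemma ro_meetUl :
  @left_distributive regular_open regular_open Order.meet Order.join.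
Proof.
move=> A B D; apply/le_anti/andP; split; last first.
  by rewrite leUx !leI2 ?leUl ?leUr.
apply/leEro; rewrite !(val_join, val_meet) -open_subsetE; last first.
  by apply: openI; [exact: open_interior | exact: open_regular_open].
move=> x [/interior_subset xAB Dx] V xV.
have xD := open_nbhs_nbhs (conj (open_regular_open D) Dx).
have [y [yAB [Vy Dy]]] := xAB _ (filterI xV xD).
by exists y; split => //; case: yAB; [left|right].
Qed.

HB.instance Definition _ := Order.Lattice_Meet_isDistrLattice.Build ro_display
  regular_open ro_meetUl.

Definition ro_bot : regular_open := of_clopen open0 closed0.
Definition ro_top : regular_open := of_clopen openT closedT.

Lemma ro_le0x A : ro_bot <= A.
Proof. by apply/leEro. Qed.

Lemma ro_lex1 A : A <= ro_top.
Proof. by apply/leEro. Qed.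

HB.instance Definition _ :=
  Order.hasBottom.Build ro_display regular_open ro_le0x.
HB.instance Definition _ :=
  Order.hasTop.Build ro_display regular_open ro_lex1.

Lemma ro_joinxC A : (A `|` ro_compl A)%O = \top.
Proof.
apply/le_anti/andP; split; first exact: lex1.
apply/leEro; rewrite val_join -open_subsetE; last exact: openT.
move=> x _ V xV.
have [yA|nAx] := pselect (closure (val A) x).
  by have [y [Ay Vy]] := yA _ xV; exists y; split=> //; left.
exists x; split; last exact: nbhs_singleton.
by right; apply: sub_regularize => //; exact/closed_openC/closed_closure.
Qed.

Lemma ro_meetxC A : (A `&` ro_compl A)%O = \bot.
Proof.
apply/val_inj; rewrite val_meet; apply/seteqP; split=> // x [Ax].
move=> /interior_subset /(_ _ (open_nbhs_nbhs (conj (open_regular_open A) Ax))).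
by move=> [y [/= nAy /subset_closure]].
Qed.

HB.instance Definition _ := Order.TBDistrLattice_hasComplement.Build ro_display
  regular_open ro_joinxC ro_meetxC.

Lemma complete_regular_open : complete_lattice regular_open.
Proof.
move=> S; split.
  exists (regularize (\bigcup_(A in S) val A)); split=> [A SA|B uB].
    apply/leEro => x Ax; apply: sub_regularize; last by exists A.
    by apply: bigcup_open => B _; exact: open_regular_open.
  by apply/leEro/regularize_sub => x [A /uB /leEro]; exact.
exists (regularize (\bigcap_(A in S) val A)°); split=> [A SA|B lB].
  by apply/leEro/regularize_sub => x /interior_subset; exact.
apply/leEro; apply: subset_trans (sub_regularize (@open_interior _ _)).
rewrite -open_subsetE; last exact: open_regular_open.
move=> x Bx A SA; by have /leEro := lB _ SA; exact.
Qed.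

End RegularOpen.
Arguments regular_open : clear implicits.

(* An alias of [set X], so that the topology below cannot clash with another
   topology on [X -> Prop]. *)
Definition subsets (X : Type) : Type := set X.

HB.instance Definition _ X := Choice.copy (subsets X) (set X).

(** * The box topology on the subsets of a space *)

Section Subsets.
Context {X : topologicalType}.
Implicit Types (F G Z : set X) (s : seq X) (x y : X).

Definition box F s : set (subsets X) :=
  [set Z | F `<=` Z /\ forall b, b \in s -> ~ Z b].

Definition box_open (U : set (subsets X)) : Prop :=
  forall Z, U Z -> exists F s, [/\ closed F, box F s Z & box F s `<=` U].

Lemma box_openT : box_open setT.
Proof.
by move=> Z _; exists set0, [::]; split=> //; [exact: closed0 | split].
Qed.

Lemma box_openI : setI_closed box_open.
Proof.
move=> U V oU oV Z [/oU[F [s [cF [FZ sZ] FU]]] /oV[G [t [cG [GZ tZ] GV]]]].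
exists (F `|` G), (s ++ t); split; first exact: closedU.
  by split=> [x [/FZ|/GZ]|b] //; rewrite mem_cat => /orP[/sZ|/tZ].
move=> Y [FGY stY]; split; [apply: FU | apply: GV]; split=> [x ?|b bs].
- by apply: FGY; left.
- by apply: stY; rewrite mem_cat bs.
- by apply: FGY; right.
- by apply: stY; rewrite mem_cat bs orbT.
Qed.

Lemma box_open_bigcup (I : Type) (f : I -> set (subsets X)) :
  (forall i, box_open (f i)) -> box_open (\bigcup_i f i).
Proof.
move=> fo Z [i _ /fo[F [s [cF FZ Ff]]]]; exists F, s; split=> //.
by move=> Y /Ff; exists i.
Qed.

End Subsets.

HB.instance Definition _ (X : topologicalType) :=
  isOpenTopological.Build (subsets X)
    (@box_openT X) (@box_openI X) (@box_open_bigcup X).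

(** The complement of a principal ideal is Scott open, so an upper set is the intersection of its
    open neighbourhoods. *)
Lemma saturatedP d (P : porderType d) (K : set (scott_space P)) :
  saturated K <-> @upper_set _ P K.
Proof.
split=> [[F Fo ->] x y xy Kx U FU|uK].
  by have [uU _] := Fo _ FU; apply: uU xy _; exact: Kx.
exists [set U | open U /\ K `<=` U]; first by move=> U [].
apply/seteqP; split=> [x Kx U [_]|x capx]; first exact.
apply: contrapT => nKx.
suff : [set z : P | ~ (z <= x)] x by apply; exact: lexx.
apply: (capx [set z : P | ~ (z <= x)]).
split; last by move=> z Kz zx; apply: nKx; exact: uK zx Kz.
rewrite scott_openE; split=> /= [a b ab nax bx|D s dD [_ sD] nsx].
  by apply: nax; exact: le_trans ab bx.
apply: contrapT => DV; apply: nsx; apply: sD => z Dz.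
by apply: contrapT => nzx; apply: DV; exists z.
Qed.

(** * Failure of co-sobriety for an abstract space [X] *)

Section NotCoSober.
Context {X : topologicalType}.
Implicit Types (F G Z : set X) (x y : X) (d e : regular_open (subsets X)).

Lemma box_openE : @open (subsets X) = box_open.
Proof. by []. Qed.

Lemma open_box F (s : seq X) : closed F -> @open (subsets X) (box F s).
Proof. by move=> cF; rewrite box_openE => Z FZ; exists F, s; split. Qed.

(** The right side is open, which makes [box F [::]] clopen and hence an element of the algebra. *)
Lemma box_nilC F :
  ~` box F [::] = \bigcup_(y in F) box set0 [:: y].
Proof.
apply/seteqP; split=> [Z nFZ|Z [y Fy [_ nZ]] [/(_ y Fy) Zy _]]; last first.
  by apply: nZ Zy; exact: mem_head.
apply: contrapT => nZ; apply: nFZ; split=> // y Fy; apply: contrapT => nZy.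
by apply: nZ; exists y => //; split=> // b; rewrite inE => /eqP ->.
Qed.

Lemma closed_box_nil F : @closed (subsets X) (box F [::]).
Proof.
by rewrite -openC box_nilC; apply: bigcup_open => y _; exact/open_box/closed0.
Qed.

Definition above F (cF : closed F) : regular_open (subsets X) :=
  of_clopen (open_box cF) (@closed_box_nil F).

Lemma le_above d F (cF : closed F) :
  d <= above cF <-> forall Z, val d Z -> F `<=` Z.
Proof.
by split=> [/leEro dF Z /dF[]|dF] //; apply/leEro => Z /dF FZ; split.
Qed.

Lemma above_le F G (cF : closed F) (cG : closed G) :
  above cF <= above cG <-> G `<=` F.
Proof.
split=> [/le_above|GF]; first by apply; split.
by apply/le_above => Z [/(subset_trans GF)].
Qed.

Context (T1 : forall x : X, closed [set x]).

(** This is [c_x] of the opening overview. *)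
Definition coord x : regular_open (subsets X) := above (@T1 x).

Lemma le_coord d x : d <= coord x <-> forall Z, val d Z -> Z x.
Proof.
split=> [/le_above dx Z /dx|dx]; first exact.
by apply/le_above => Z /dx Zx _ ->.
Qed.

Lemma above_le_coord F (cF : closed F) x : above cF <= coord x <-> F x.
Proof.
by split=> [/above_le|Fx]; [apply | apply/above_le => _ ->].
Qed.

Lemma coord_le_coord x y : coord x <= coord y -> x = y.
Proof. by move/above_le_coord. Qed.

Definition upper_coords d : set X := [set x | d <= coord x].

Lemma closed_upper_coords d : closed (upper_coords d).
Proof.
suff -> : upper_coords d = \bigcap_(F in [set F | closed F /\ val d F]) F.
  by apply: closed_bigI => F [].
apply/seteqP; split=> x; first by move=> /le_coord dx F [_ /dx].
move=> capx; apply/le_coord => Z dZ.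
(* A basic box around [Z] inside [d] also contains its own closed set [F], so [F] is a closed member
   of [d] below [Z]. *)
have [F [s [cF [FZ sZ] Fd]]] := @open_regular_open _ d Z dZ.
apply: (FZ); apply: capx; split=> //; apply: Fd.
by split=> // b /sZ nZb Fb; apply: nZb; exact: FZ.
Qed.

Definition missing F : set (regular_open (subsets X)) :=
  [set d | ~ (F `&` upper_coords d !=set0)].

Context (X_compact : cover_compact [set: X]).

(** If a directed [D] avoids [missing F], the closed sets of [y] in [F] with [d <= coord y] are
    filtered and nonempty; by compactness one [y] serves all [d] in [D], hence also the supremum. *)
Lemma scott_open_missing F : closed F -> scott_open (missing F).
Proof.
move=> cF; split=> [d e de nFd [y [Fy ye]]|D s [[d0 Dd0] dD] [_ sD] nFs].
  by apply: nFd; exists y; split=> //; exact: le_trans de ye.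
apply: contrapT => DF.
have Dn0 d : D d -> F `&` upper_coords d !=set0.
  by move=> Dd; apply: contrapT => nFd; apply: DF; exists d.
have [||||y capy] := @cover_compact_filtered X
    [set G | exists2 d, D d & F `&` upper_coords d = G].
- by [].
- by move=> _ [d Dd <-]; apply: closedI => //; exact: closed_upper_coords.
- split; first by exists (F `&` upper_coords d0), d0.
  move=> _ _ [d Dd <-] [e De <-]; have [g [Dg dg eg]] := dD _ _ Dd De.
  exists (F `&` upper_coords g); first by exists g.
  move=> x [Fx gx].
  by do 2!split=> //; [exact: le_trans dg gx | exact: le_trans eg gx].
- by move=> _ [d Dd <-]; exact: Dn0.
apply: nFs; exists y; split.
  by have [] := capy (F `&` upper_coords d0); first by exists d0.
apply: sD => d Dd.
by have [] := capy (F `&` upper_coords d); first by exists d.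
Qed.

Lemma supremums_above (FF : set (set X)) x :
    filtered FF -> FF `<=` closed -> \bigcap_(F in FF) F = [set x] ->
  let D := [set d | exists F (cF : closed F), FF F /\ d = above cF] in
  directed D /\ supremums D (coord x).
Proof.
move=> fFF cFF capF D; have [[F0 FF0] dFF] := fFF; split; split.
- by exists (above (cFF _ FF0)), F0, (cFF _ FF0).
- move=> _ _ [F [cF [FFF ->]]] [G [cG [FFG ->]]].
  have [H FFH HFG] := dFF _ _ FFF FFG.
  exists (above (cFF _ FFH)); split; first by exists H, (cFF _ FFH).
    by apply/above_le => y /HFG[].
  by apply/above_le => y /HFG[].
- move=> _ [F [cF [FFF ->]]]; apply/above_le_coord.
  by have : (\bigcap_(F in FF) F) x by [rewrite capF]; exact.
(* As [u] is regular open, it is enough that its closure contains [coord x]. *)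
move=> u uD; apply/leEro; apply: sub_regular_open.
  exact: open_regular_open.
move=> Z [Zx _] V; rewrite nbhsE => -[W [oW WZ] WV].
have [G [s [cG [GZ sZ] GW]]] := oW _ WZ.
have xNs : x \notin s by apply/negP => /sZ; apply; exact: Zx.
(* Since [F] avoids the finite [s], the union of [F] and [G] is in [box G s]; containing [F], it is
   also in [u]. *)
have [|F FFF Fs] := filtered_avoid fFF _ xNs; first by rewrite capF.
exists (F `|` G); split.
  have /leEro : above (cFF _ FFF) <= u by apply: uD; exists F, (cFF _ FFF).
  by apply; split=> // y Fy; left.
apply/WV/GW; split=> [y Gy|b bs []]; [by right | exact: Fs |].
by move/GZ; exact: sZ.
Qed.

Context (X_kspace : forall B : set X,
  (forall (FF : set (set X)) x, filtered FF -> FF `<=` closed ->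
     \bigcap_(F in FF) F = [set x] -> (forall F, FF F -> F `&` B !=set0) ->
     B x) ->
  closed B).

(** If [U] contains [coord x], it contains [above F] for some [F] of a family shrinking to [x], and
    with it [coord y] for all [y] in [F]. *)
Lemma open_coord_preimage (U : set (regular_open (subsets X))) :
  scott_open U -> open [set x | U (coord x)].
Proof.
move=> [uU sU]; rewrite -closedC; apply: X_kspace => FF x fFF cFF capF FB /= Ux.
have [dD sD] := supremums_above fFF cFF capF.
have [_ [[F [cF [FFF ->]]] UF]] := sU _ _ dD sD Ux.
have [y [Fy]] := FB _ FFF; apply; apply: uU UF; exact/above_le_coord.
Qed.

Definition coords_filter : set (scott_space (regular_open (subsets X))) :=
  [set d | exists x, coord x <= d].

Lemma cover_compact_coords_filter : cover_compact coords_filter.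
Proof.
apply/cover_compactP => UU oUU [UU0 dUU KUU].
pose pre (U : set (regular_open (subsets X))) := [set x | U (coord x)].
move/cover_compactP : X_compact.
move=> /(_ [set V | exists2 U, UU U & pre U = V])[||_ [U UUU <-] TU].
- by move=> _ [U /oUU oU <-]; exact: open_coord_preimage.
- split; first by have [U UUU] := UU0; exists (pre U), U.
    move=> _ _ [U UUU <-] [V UUV <-]; have [W UUW UVW] := dUU _ _ UUU UUV.
    by exists (pre W) => [|x ?]; [exists W | exact: UVW].
  move=> x _; have [|U UUU Ux] := KUU (coord x); first by exists x.
  by exists (pre U) => //; exists U.
exists U => // d [x xd].
by have [uU _] := oUU _ UUU; apply: uU xd _; exact: TU.
Qed.

(** Let the [F] shrink to [x] and meet the preimage, with [coord x] outside [K]. The sets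
    [missing F] then cover [K], so one of them contains [K], although that [F] has a [y] with
    [coord y] in [K]. *)
Lemma closed_coord_preimage (K : set (scott_space (regular_open (subsets X)))) :
    K `<=` coords_filter -> cover_compact K -> saturated K ->
  closed [set x | K (coord x)].
Proof.
move=> sK /cover_compactP cK /saturatedP uK.
apply: X_kspace => FF x [[F0 FF0] dFF] cFF capF FB; apply: contrapT => /= nKx.
have [||_ [F FFF <-] KF] := cK [set U | exists2 F, FF F & missing F = U].
- by move=> _ [F /cFF cF <-]; exact: scott_open_missing.
- split; first by exists (missing F0), F0.
    move=> _ _ [F FFF <-] [G FFG <-]; have [H FFH HFG] := dFF _ _ FFF FFG.
    exists (missing H); first by exists H.
    by move=> d [] nd [y [/HFG[Fy Gy] dy]]; apply: nd; exists y.
  move=> d Kd; apply: contrapT => nd.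
  have Fd F : FF F -> F `&` upper_coords d !=set0.
    move=> FFF; apply: contrapT => nFd; apply: nd.
    by exists (missing F) => //; exists F.
  have [||||y capy] := @cover_compact_filtered X
      [set G | exists2 F, FF F & F `&` upper_coords d = G].
  + by [].
  + move=> _ [F /cFF cF <-].
    by apply: closedI => //; exact: closed_upper_coords.
  + split; first by exists (F0 `&` upper_coords d), F0.
    move=> _ _ [F FFF <-] [G FFG <-]; have [H FFH HFG] := dFF _ _ FFF FFG.
    exists (H `&` upper_coords d); first by exists H.
    by move=> z [/HFG[]].
  + by move=> _ [F FFF <-]; exact: Fd.
  have dy : d <= coord y.
    by have [] := capy (F0 `&` upper_coords d); first by exists F0.
  have yx : y = x.
    suff : (\bigcap_(F in FF) F) y by rewrite capF.
    by move=> F FFF; have [] := capy (F `&` upper_coords d); first by exists F.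
  (* Here [d] lies between [coord m] and [coord x], members of an antichain, so it equals
     [coord x]. *)
  have [m md] := sK _ Kd; move: dy; rewrite yx => dx.
  have mx := coord_le_coord (le_trans md dx).
  by apply: nKx; rewrite (_ : coord x = d)//; apply/le_anti; rewrite dx -mx md.
have [y [Fy Ky]] := FB _ FFF.
by apply: (KF _ Ky); exists y; split=> //; exact: lexx.
Qed.

Context (X_irreducible : forall F G : set X, closed F -> closed G ->
  F `|` G = setT -> F = setT \/ G = setT).

(** The closed preimages of [K] and [L] under [coord] cover [X], so one of them is all of [X]. *)
Lemma k_irreducible_coords_filter (x0 : X) : k_irreducible coords_filter.
Proof.
split.
  split; first by exists (coord x0), x0; exact: lexx.
    exact: cover_compact_coords_filter.
  by apply/saturatedP => d e de [x xd]; exists x; exact: le_trans xd de.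
move=> K L [_ cK sK] [_ cL sL] KL.
have [sKf sLf] : K `<=` coords_filter /\ L `<=` coords_filter.
  by rewrite KL; split=> d; [left|right].
have full M : M `<=` coords_filter -> saturated M ->
    [set x | M (coord x)] = setT -> coords_filter = M.
  move=> sMf /saturatedP uM MT; apply/seteqP; split=> // d [x xd].
  by apply: uM xd _; have : [set x | M (coord x)] x by rewrite MT.
have [|||KT|LT] := @X_irreducible [set x | K (coord x)] [set x | L (coord x)].
- exact: closed_coord_preimage.
- exact: closed_coord_preimage.
- apply/seteqP; split=> // x _.
  have : coords_filter (coord x) by exists x; exact: lexx.
  by rewrite KL.
- by left; exact: full.
- by right; exact: full.
Qed.

Lemma not_co_sober_regular_open (a b : X) :
  a <> b -> ~ co_sober (scott_space (regular_open (subsets X))).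
Proof.
move=> ab /(_ _ (k_irreducible_coords_filter a))[d Kd].
have below x : d <= coord x.
  have : coords_filter (coord x) by exists x; exact: lexx.
  by rewrite Kd => /scott_specialization.
(* Lying above [coord m] and below [coord a] and [coord b], the least element [d] forces
   [a = m = b]. *)
have [m md] : coords_filter d by rewrite Kd; apply/scott_specialization/lexx.
apply: ab; rewrite -(coord_le_coord (le_trans md (below a))).
exact: coord_le_coord (le_trans md (below b)).
Qed.

End NotCoSober.

(** * The sequential space of rows and graphs *)

Inductive grid : Type :=
  | leaf of nat
  | node of grid & grid & nat & nat.

(** The point [(k, n)] of the copy of [nat * nat] attached to [(p, q)] is [node p q k n]; its rows
    are to converge to [p] and its graphs of functions to [q]. *)
Inductive seq_index : Type :=
  | row of grid & grid & nat
  | graph of grid & grid & (nat -> nat).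

Definition term (j : seq_index) (n : nat) : grid :=
  match j with
  | row p q k => node p q k n
  | graph p q f => node p q n (f n)
  end.

Definition limit (j : seq_index) : grid :=
  match j with row p q k => p | graph p q f => q end.

Lemma term_inj j : injective (term j).
Proof. by case: j => [p q k|p q f] m n []. Qed.

Lemma term_neq_leaf j n m : term j n <> leaf m.
Proof. by case: j. Qed.

Lemma term_avoid j (y : grid) :
  exists N, forall n, (N <= n)%N -> term j n <> y.
Proof.
have [[m <-]|ny] := pselect (exists m, term j m = y).
  by exists m.+1 => n mn /term_inj nm; rewrite nm ltnn in mn.
by exists 0%N => n _ ny'; apply: ny; exists n.
Qed.

(** Sequences of the same kind with different limits live in different copies, and a row meets a
    graph in at most one point. *)
Lemma term_almost_disjoint i j : limit i <> limit j ->
  exists N, forall n, (N <= n)%N -> forall m, term i n <> term j m.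
Proof.
case: i => [p q k|p q f]; case: j => [p' q' k'|p' q' f'] /= ij.
- by exists 0%N => n _ m [].
- exists (f' k).+1 => n kn m [_ _ km]; rewrite -km => nk.
  by rewrite nk ltnn in kn.
- by exists k'.+1 => n kn m [_ _ nk]; rewrite nk ltnn in kn.
- by exists 0%N => n _ m [].
Qed.

(** This is the finest topology in which every [term j] converges to [limit j]. *)
Definition seq_open (U : set grid) : Prop :=
  forall j, U (limit j) -> exists N, forall n, (N <= n)%N -> U (term j n).

Lemma seq_openT : seq_open setT.
Proof. by move=> j _; exists 0%N. Qed.

Lemma seq_openI : setI_closed seq_open.
Proof.
move=> U V oU oV j [/oU[M UM] /oV[N VN]]; exists (maxn M N) => n.
by rewrite geq_max => /andP[/UM ? /VN].
Qed.

Lemma seq_open_bigcup (I : Type) (f : I -> set grid) :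
  (forall i, seq_open (f i)) -> seq_open (\bigcup_i f i).
Proof.
move=> fo j [i _ /(fo i)[N fN]]; exists N => n Nn.
by exists i => //; exact: fN.
Qed.

HB.instance Definition _ := gen_eqMixin grid.
HB.instance Definition _ := gen_choiceMixin grid.
HB.instance Definition _ := isPointed.Build grid (leaf 0).
HB.instance Definition _ :=
  isOpenTopological.Build grid seq_openT seq_openI seq_open_bigcup.

(** * One-point compactification; convergent sequences as compact closed sets *)

Local Notation opc := one_point_compactification.

Lemma opc_openP (T : topologicalType) (U : set (opc T)) :
  open U <-> open [set y : T | U (Some y)] /\
             (U None -> compact [set y : T | ~ U (Some y)]).
Proof.
split=> [oU|[oU cU]].
  have oU' : open [set y : T | U (Some y)].
    by apply: (@open_comp _ _ (Some : T -> opc T)) => // y _;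
      exact: one_point_compactification_some_continuous.
  split=> // UN; have [K [cK _] KU] := open_nbhs_nbhs (conj oU UN).
  apply: subclosed_compact cK _; first exact: open_closedC.
  move=> y nUy; apply: contrapT => nKy; apply: nUy; apply: KU.
  by left; exists y.
rewrite openE => -[y|] Uy; first exact: (open_nbhs_nbhs (conj oU Uy)).
exists [set y | ~ U (Some y)]; first by split; [exact: cU|exact: open_closedC].
by move=> x [[y nnUy <-]|->]; [exact: contrapT nnUy|].
Qed.

Lemma opc_closedP (T : topologicalType) (F : set (opc T)) :
  closed F <-> closed [set y : T | F (Some y)] /\
               (F None \/ compact [set y : T | F (Some y)]).
Proof.
rewrite -openC opc_openP; split=> -[oF cF]; split.
- by rewrite -openC.
- have [?|nF] := pselect (F None); [by left|right].
  have := cF nF; congr (compact _).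
  by apply/funext => y; apply/propext; split=> [/contrapT|Fy []].
- by move: oF; rewrite -openC.
- case: cF => [? []//|+ _]; congr (compact _).
  by apply/funext => y; apply/propext; split=> [Fy []|/contrapT].
Qed.

Lemma seq_openE : @open grid = seq_open.
Proof. by []. Qed.

Lemma seq_closedP (B : set grid) : closed B <->
  forall j, (forall N, exists2 n, (N <= n)%N & B (term j n)) -> B (limit j).
Proof.
rewrite -openC seq_openE; split=> [oB j fB|Bl j nBj].
  apply: contrapT => /oB[N BN]; have [n Nn Bn] := fB N; exact: BN Bn.
apply: contrapT => nN; apply/nBj/Bl => N; apply: contrapT => nB; apply: nN.
by exists N => n Nn Bn; apply: nB; exists n.
Qed.

Lemma closed_grid1 (y : grid) : closed [set y].
Proof.
apply/seq_closedP => j fy; have [N jN] := term_avoid j y.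
by have [n /jN] := fy N.
Qed.

Definition tail (j : seq_index) (N : nat) : set grid :=
  limit j |` [set term j n | n in [set n | (N <= n)%N]].

(** A sequence with another limit meets the tail only finitely often. *)
Lemma closed_tail j N : closed (tail j N).
Proof.
apply/seq_closedP => i fT; have [->|ij] := pselect (limit i = limit j).
  by left.
have [M iM] := term_almost_disjoint ij.
have [M' iM'] := term_avoid i (limit j).
have [n] := fT (maxn M M'); rewrite geq_max => /andP[Mn M'n].
by case=> [/(iM' _ M'n)|[m _ /esym/(iM _ Mn)]].
Qed.

(** A member of the cover around the limit contains almost all terms; directedness absorbs the
    others one by one. *)
Lemma compact_tail j N : compact (tail j N).
Proof.
rewrite compact_cover; apply/cover_compactP => UU oUU [_ dUU TU].
have [|U UUU Ul] := TU (limit j); first by left.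
have [M UM] := oUU _ UUU _ Ul.
suff [W UW WM] : exists2 W, UU W & U `<=` W /\
    forall n, (N <= n < M)%N -> W (term j n).
  have [sUW jW] := WM; exists W => // y [->|[n /= Nn <-]]; first exact: sUW.
  have [nM|Mn] := ltnP n M; first by apply: jW; rewrite Nn.
  by apply: sUW; exact: UM.
elim: M {UM} => [|M [W UW [sUW WM]]].
  by exists U => //; split=> // n; rewrite andbF.
have [MN|NM] := ltnP M N.
  exists W => //; split=> // n /andP[Nn nM].
  by move: (leq_trans nM MN); rewrite ltnNge Nn.
have [|V UV VM] := TU (term j M); first by right; exists M.
have [A UA WVA] := dUU _ _ UW UV; exists A => //; split=> [y Uy|n].
  by apply: WVA; left; exact: sUW.
rewrite ltnS => /andP[Nn]; rewrite leq_eqVlt => /predU1P[->|nM].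
  by apply: WVA; right.
by apply: WVA; left; apply: WM; rewrite Nn.
Qed.

(** * The compactified space satisfies the assumptions on [X] *)

Lemma closed_opc1 (x : opc grid) : closed [set x].
Proof.
apply/opc_closedP; case: x => [y|]; last first.
  rewrite (_ : [set y | _] = set0); last by apply/seteqP; split.
  by split; [exact: closed0|left].
rewrite (_ : [set z | _] = [set y]); last first.
  by apply/seteqP; split=> z [->].
by split; [exact: closed_grid1 | right; exact: compact_set1].
Qed.

Lemma opc_grid_kspace (B : set (opc grid)) :
    (forall (FF : set (set (opc grid))) x, filtered FF -> FF `<=` closed ->
      \bigcap_(F in FF) F = [set x] -> (forall F, FF F -> F `&` B !=set0) ->
      B x) ->
  closed B.
Proof.
move=> BP; have cB : closed [set y | B (Some y)].
  apply/seq_closedP => j fB.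
  (* The tails shrink to the limit because the terms are pairwise distinct. *)
  apply: (BP [set F | exists N, F = Some @` tail j N] (Some (limit j))).
  - split; first by exists (Some @` tail j 0), 0%N.
    move=> _ _ [M ->] [N ->]; exists (Some @` tail j (maxn M N)).
      by exists (maxn M N).
    move=> _ [y jy <-]; split; exists y => //.
      case: jy => [->|[n /= + <-]]; first by left.
      by rewrite geq_max => /andP[Mn _]; right; exists n.
    case: jy => [->|[n /= + <-]]; first by left.
    by rewrite geq_max => /andP[_ Nn]; right; exists n.
  - move=> _ [N ->]; apply/opc_closedP.
    rewrite (_ : [set y | _] = tail j N); last first.
      by apply/seteqP; split=> y => [[z jz [<-]]|jy] //; exists y.
    by split; [exact: closed_tail | right; exact: compact_tail].
  - apply/seteqP; split=> [x capx|_ -> _ [N ->]]; last first.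
      by exists (limit j) => //; left.
    have [|y [->|[n _ ny]] yx] := capx (Some @` tail j 0); first by exists 0%N.
      by rewrite /= -yx.
    have [|z [->|[m /= nm mz]] zx] := capx (Some @` tail j n.+1).
    + by exists n.+1.
    + by rewrite /= -zx.
    + move: zx; rewrite -yx -mz -ny => -[/term_inj mn].
      by rewrite mn ltnn in nm.
  - move=> _ [N ->]; have [n Nn Bn] := fB N; exists (Some (term j n)).
    split=> //.
    by exists (term j n) => //; right; exists n.
apply/opc_closedP; split=> //.
have [?|nBN] := pselect (B None); [by left|right].
rewrite compact_cover; apply/cover_compactP => UU oUU [[U0 UU0] dUU BU].
apply: contrapT => nU; apply: nBN.
(* No member of [UU] contains the trace of [B]. So the closed sets [out U], made of infinity and the
   part of [B] outside [U], all meet [B]; as they shrink to infinity, [B] contains it. *)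
pose out (U : set grid) : set (opc grid) :=
  [set x | if x is Some y then ~ (U `|` ~` [set y | B (Some y)]) y else True].
apply: (BP [set F | exists2 U, UU U & F = out U]).
- split; first by exists (out U0), U0.
  move=> _ _ [U UUU ->] [V UUV ->]; have [W UUW UVW] := dUU _ _ UUU UUV.
  exists (out W); first by exists W.
  move=> [y|] nW; split=> // -[?|nBy]; apply: nW; try by right.
    by left; apply: UVW; left.
  by left; apply: UVW; right.
- move=> _ [U UUU ->]; apply/opc_closedP; split; last by left.
  rewrite (_ : [set y | _] = ~` (U `|` ~` [set y | B (Some y)]))//.
  apply: open_closedC; apply: openU; first exact: oUU.
  exact: closed_openC.
- apply/seteqP; split=> [[y|]|x -> _ [U _ ->]] // capy; exfalso.
  have [By|nBy] := pselect (B (Some y)); last first.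
    by have := capy (out U0) (ex_intro2 _ _ _ UU0 erefl); apply; right.
  have [U UUU Uy] := BU _ By.
  by have := capy (out U) (ex_intro2 _ _ _ UUU erefl); apply; left.
- move=> _ [U UUU ->]; apply: contrapT => nF; apply: nU; exists U => // y By.
  apply: contrapT => nUy; apply: nF; exists (Some y); split=> //=.
  by case=> [|/(_ By)].
Qed.

(** No sequence has a leaf among its terms, so removing any set of leaves from the space leaves an
    open set. *)
Lemma grid_not_compact : ~ compact [set: grid].
Proof.
rewrite compact_cover => /cover_compactP cT.
pose U n : set grid := [set y | forall m, (n <= m)%N -> y <> leaf m].
have [||_ [n <-] TU] := cT [set V | exists n, U n = V].
- move=> _ [n <-]; rewrite seq_openE => j _.
  by exists 0%N => k _ m _; exact: term_neq_leaf.
- split; first by exists (U 0%N), 0%N.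
    move=> _ _ [m <-] [n <-]; exists (U (maxn m n)); first by exists (maxn m n).
    by move=> y [Uy|Uy] k; rewrite geq_max => /andP[mk nk]; exact: Uy.
  move=> y _; case: y => [m|p q k n]; last by exists (U 0%N) => //; exists 0%N.
  exists (U m.+1); first by exists m.+1.
  by move=> k mk [mk']; rewrite mk' ltnn in mk.
exact: (TU (leaf n) I n).
Qed.

Lemma opc_grid_irreducible (F G : set (opc grid)) : closed F -> closed G ->
  F `|` G = setT -> F = setT \/ G = setT.
Proof.
(* A closed set containing all of the grid also contains infinity, as the grid is not compact. *)
have missed (H : set (opc grid)) :
    closed H -> H <> setT -> exists y, ~ H (Some y).
  move=> /opc_closedP[_ cH] HT; apply: contrapT => Hfull.
  have HS y : H (Some y) by apply: contrapT => nHy; apply: Hfull; exists y.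
  case: cH => [HN|cH]; first by apply: HT; apply/seteqP; split=> // -[y|].
  apply: grid_not_compact; move: cH; congr (compact _).
  by apply/seteqP; split=> // y _; exact: HS.
move=> cF cG FGT; apply: contrapT => /not_orP[FT GT].
have [p nFp] := missed F cF FT.
have [q nGq] := missed G cG GT.
have [/seq_closedP {}cF _] := (opc_closedP _).1 cF.
have [/seq_closedP {}cG _] := (opc_closedP _).1 cG.
(* A row inside [F] would put its limit [p] in [F]; so [f] can pick an entry outside [F] in each
   row. *)
have /choice[f Ff] k : exists n, ~ F (Some (node p q k n)).
  apply: contrapT => nF; apply: nFp; apply: (cF (row p q k)) => N.
  by exists N => //; apply: contrapT => nFN; apply: nF; exists N.
(* The graph of [f] avoids [F], hence lies in [G] together with its limit [q]. *)
apply: nGq; apply: (cG (graph p q f)) => N; exists N => //.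
have : (F `|` G) (Some (node p q N (f N))) by rewrite FGT.
by case=> // /Ff.
Qed.

Theorem theorem5p2 :
  exists (d : Order.disp_t) (C : ctbDistrLatticeType d),
    complete_lattice C /\ ~ co_sober (scott_space C).
Proof.
exists ro_display, (regular_open (subsets (opc grid))); split.
  exact: complete_regular_open.
apply: (@not_co_sober_regular_open _ closed_opc1 _ opc_grid_kspace
  opc_grid_irreducible None (Some (leaf 0))) => //.
rewrite -compact_cover.
exact: one_point_compactification_compact.
Qed.
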